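(* Let $p$ be a prime, $G$ a cyclic group of order $p$, and $L=\mathbb{Z}_pG$. For $n\ge 1$ let $c_n(L)$ denote the number of $\mathbb{Z}_pG$-submodules of $L$ of index $p^n$ which are free as $\mathbb{Z}_pG$-modules, and let $Z_{\mathrm{coh}}(L;s)=\sum_{n\ge 1}c_n(L)p^{-ns}$. Then $$Z_{\mathrm{coh}}(L;s)=\frac{(p-1)p^{-2s}}{(1-p^{-s})^2}.$$
   Context: $\mathbb{Z}_p$ is the ring of $p$-adic integers. The identity can be read as an identity of formal power series in $p^{-s}$ (equivalently, for complex $s$ with $\mathrm{Re}(s)>0$). *)

(* Defs.v *)
From HB Require Import structures.
From mathcomp Require Import all_boot all_order all_algebra all_fingroup
  all_solvable.
From mathcomp Require Import finmap.
From mathcomp Require Import mathcomp_extra boolp classical_sets functions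
  cardinality.

Set Implicit Arguments.
Unset Strict Implicit.
Unset Printing Implicit Defensive.

Import GRing.Theory.
Local Open Scope ring_scope.

(* The p-adic integers: the inverse limit of the rings Z/p^k; a p-adic integer
   is the sequence of its residues mod p^k, each of them represented by the
   natural number r_k < p^k (the bound follows from the compatibility
   condition).  The type depends on the primality proof, which ensures that
   the ring is nontrivial. *)

Record padic_int (p : nat) (p_pr : prime p) := PadicInt {
  pres :> nat -> nat;
  presP : forall k, pres k = (pres k.+1 %% p ^ k)%N }.

Section PadicInt.
Variables (p : nat) (p_pr : prime p).
Local Notation Zp := (padic_int p_pr).

HB.instance Definition _ := gen_eqMixin Zp.
HB.instance Definition _ := gen_choiceMixin Zp.

Lemma padicP (x y : Zp) : (forall k, x k = y k) -> x = y.
Proof.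
case: x y => [x xP] [y yP] /= /funext exy; case: y / exy yP => yP.
by congr PadicInt; apply: Prop_irrelevance.
Qed.

Lemma pres_mod (x : Zp) k : (x k %% p ^ k)%N = x k.
Proof. by rewrite [in RHS]presP [in LHS]presP modn_mod. Qed.

Fact modn_compat (f : nat -> nat) :
  (forall k, f k = f k.+1 %[mod p ^ k]) ->
  forall k, (f k %% p ^ k = (f k.+1 %% p ^ k.+1) %% p ^ k)%N.
Proof. by move=> fP k; rewrite modn_dvdm ?dvdn_exp2l. Qed.

Lemma pres_modS (x : Zp) k : x k = x k.+1 %[mod p ^ k].
Proof. by rewrite [in LHS]presP modn_mod. Qed.

Fact padic_add_subproof (x y : Zp) k :
  (x k + y k = x k.+1 + y k.+1 %[mod p ^ k])%N.
Proof. by rewrite -modnDm !pres_modS modnDm. Qed.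

Fact padic_mul_subproof (x y : Zp) k :
  (x k * y k = x k.+1 * y k.+1 %[mod p ^ k])%N.
Proof. by rewrite -modnMm !pres_modS modnMm. Qed.

Fact padic_opp_subproof (x : Zp) k :
  (p ^ k - x k = p ^ k.+1 - x k.+1 %[mod p ^ k])%N.
Proof.
have pX0 j : (0 < p ^ j)%N by rewrite expn_gt0 prime_gt0.
have lex j : (x j <= p ^ j)%N by rewrite -pres_mod ltnW // ltn_pmod.
apply/eqP; rewrite -(eqn_modDr (x k)) subnK // -modnDmr pres_modS modnDmr.
by rewrite subnK // modnn eq_sym expnSr modnMr.
Qed.

Definition padic_of (f : nat -> nat)
    (fP : forall k, (f k = f k.+1 %[mod p ^ k])%N) : Zp :=
  PadicInt p_pr (modn_compat fP).

Definition padic_nat (n : nat) : Zp := @padic_of (fun=> n) (fun=> erefl).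
Definition padic_add x y : Zp := padic_of (padic_add_subproof x y).
Definition padic_mul x y : Zp := padic_of (padic_mul_subproof x y).
Definition padic_opp x : Zp := padic_of (padic_opp_subproof x).

Fact padic_addA : associative padic_add.
Proof. by move=> x y z; apply: padicP => k /=; rewrite modnDmr modnDml addnA. Qed.
Fact padic_addC : commutative padic_add.
Proof. by move=> x y; apply: padicP => k /=; rewrite addnC. Qed.
Fact padic_add0 : left_id (padic_nat 0) padic_add.
Proof. by move=> x; apply: padicP => k /=; rewrite mod0n add0n pres_mod. Qed.
Fact padic_addN : left_inverse (padic_nat 0) padic_opp padic_add.
Proof.
move=> x; apply: padicP => k /=.
have pX0 : (0 < p ^ k)%N by rewrite expn_gt0 prime_gt0.
have lex : (x k <= p ^ k)%N by rewrite -pres_mod ltnW // ltn_pmod.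
by rewrite modnDml subnK // modnn mod0n.
Qed.
HB.instance Definition _ :=
  GRing.isZmodule.Build Zp padic_addA padic_addC padic_add0 padic_addN.

Fact padic_mulA : associative padic_mul.
Proof. by move=> x y z; apply: padicP => k /=; rewrite modnMmr modnMml mulnA. Qed.
Fact padic_mulC : commutative padic_mul.
Proof. by move=> x y; apply: padicP => k /=; rewrite mulnC. Qed.
Fact padic_mul1 : left_id (padic_nat 1) padic_mul.
Proof. by move=> x; apply: padicP => k /=; rewrite modnMml mul1n pres_mod. Qed.
Fact padic_mulDl : left_distributive padic_mul padic_add.
Proof.
by move=> x y z; apply: padicP => k /=; rewrite modnMml modnDm mulnDl.
Qed.
Fact padic_1neq0 : padic_nat 1 != 0 :> Zp.
Proof.
apply/eqP => /(congr1 (fun x : Zp => x 1%N)) /=.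
by rewrite expn1 mod0n modn_small ?prime_gt1.
Qed.
HB.instance Definition _ := GRing.Zmodule_isComNzRing.Build Zp
  padic_mulA padic_mulC padic_mul1 padic_mulDl padic_1neq0.

End PadicInt.

(* Elements of the group ring are the coefficient functions G -> R; the
   product is convolution (not the pointwise product that {ffun G -> R}
   carries in ssralg). *)

Definition group_ring (R : nzRingType) (G : finGroupType) := {ffun G -> R}.

Section GroupRing.
Variables (R : nzRingType) (G : finGroupType).
Local Notation RG := (group_ring R G).

HB.instance Definition _ := GRing.Zmodule.on RG.

Definition gr_one : RG := [ffun x => (x == 1%g)%:R].
Definition gr_mul (a b : RG) : RG :=
  [ffun x => \sum_(y : G) a y * b (y^-1 * x)%g].

Fact gr_mulA : associative gr_mul.
Proof.
move=> a b c; apply/ffunP => x; rewrite !ffunE.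
under eq_bigr => y _ do rewrite ffunE big_distrr /=.
under [RHS]eq_bigr => y _ do rewrite ffunE big_distrl /=.
rewrite [RHS]exchange_big /=; apply: eq_bigr => y _.
rewrite [RHS](reindex_inj (mulgI y)) /=; apply: eq_bigr => z _.
by rewrite mulrA mulKg invMg mulgA.
Qed.
Fact gr_mul1l : left_id gr_one gr_mul.
Proof.
move=> a; apply/ffunP => x; rewrite ffunE (bigD1 1%g) //= ffunE eqxx mul1r.
rewrite invg1 mul1g big1 ?addr0 // => y /negPf y1.
by rewrite ffunE y1 mul0r.
Qed.
Fact gr_mul1r : right_id gr_one gr_mul.
Proof.
move=> a; apply/ffunP => x; rewrite ffunE (bigD1 x) //= ffunE mulVg eqxx mulr1.
rewrite big1 ?addr0 // => y yx; rewrite ffunE.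
by rewrite -eq_mulVg1 (negPf yx) mulr0.
Qed.
Fact gr_mulDl : left_distributive gr_mul +%R.
Proof.
move=> a b c; apply/ffunP => x; rewrite !ffunE -big_split /=.
by apply: eq_bigr => y _; rewrite ffunE mulrDl.
Qed.
Fact gr_mulDr : right_distributive gr_mul +%R.
Proof.
move=> a b c; apply/ffunP => x; rewrite !ffunE -big_split /=.
by apply: eq_bigr => y _; rewrite ffunE mulrDr.
Qed.
Fact gr_1neq0 : gr_one != 0 :> RG.
Proof.
apply/eqP => /ffunP /(_ 1%g); rewrite !ffunE eqxx => /eqP.
by rewrite oner_eq0.
Qed.
HB.instance Definition _ := GRing.Zmodule_isNzRing.Build RG
  gr_mulA gr_mul1l gr_mul1r gr_mulDl gr_mulDr gr_1neq0.

End GroupRing.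

Record fps (R : Type) := FPS { fps_coef : nat -> R }.

Section FPS.
Variable R : comNzRingType.

HB.instance Definition _ := gen_eqMixin (fps R).
HB.instance Definition _ := gen_choiceMixin (fps R).

Lemma fpsP (f g : fps R) : (forall n, fps_coef f n = fps_coef g n) -> f = g.
Proof. by case: f g => [f] [g] /= /funext ->. Qed.

Definition fps_zero : fps R := FPS (fun=> 0).
Definition fps_one : fps R := FPS (fun n => (n == 0%N)%:R).
Definition fps_opp (f : fps R) := FPS (fun n => - fps_coef f n).
Definition fps_add (f g : fps R) := FPS (fun n => fps_coef f n + fps_coef g n).
Definition fps_mul (f g : fps R) :=
  FPS (fun n => \sum_(i < n.+1) fps_coef f i * fps_coef g (n - i)%N).

Fact fps_addA : associative fps_add.
Proof. by move=> f g h; apply: fpsP => n /=; rewrite addrA. Qed.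
Fact fps_addC : commutative fps_add.
Proof. by move=> f g; apply: fpsP => n /=; rewrite addrC. Qed.
Fact fps_add0 : left_id fps_zero fps_add.
Proof. by move=> f; apply: fpsP => n /=; rewrite add0r. Qed.
Fact fps_addN : left_inverse fps_zero fps_opp fps_add.
Proof. by move=> f; apply: fpsP => n /=; rewrite addNr. Qed.
HB.instance Definition _ :=
  GRing.isZmodule.Build (fps R) fps_addA fps_addC fps_add0 fps_addN.

(* The first m coefficients of a product are those of a product of
   polynomials. *)
Let trunc n (f : fps R) : {poly R} := \poly_(i < n) fps_coef f i.

Let fps_mulE n m (f g : fps R) : (n < m)%N ->
  fps_coef (fps_mul f g) n = (trunc m f * trunc m g)`_n.
Proof.
move=> nm; rewrite coefM /=; apply: eq_bigr => i _; rewrite !coef_poly.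
by rewrite (leq_ltn_trans _ nm) ?(leq_ltn_trans (leq_subr _ _) nm) // -ltnS.
Qed.

Fact fps_mulA : associative fps_mul.
Proof.
move=> f g h; apply: fpsP => n.
transitivity ((trunc n.+1 f * (trunc n.+1 g * trunc n.+1 h))`_n).
  rewrite coefM /=; apply: eq_bigr => i _; rewrite coef_poly ltn_ord.
  by rewrite -fps_mulE // ltnS leq_subr.
rewrite mulrA coefM /=; apply: eq_bigr => i _; rewrite coef_poly ltnS leq_subr.
by rewrite -fps_mulE.
Qed.
Fact fps_mulC : commutative fps_mul.
Proof.
by move=> f g; apply: fpsP => n; rewrite !(@fps_mulE n n.+1) // mulrC.
Qed.
Fact fps_mul1 : left_id fps_one fps_mul.
Proof.
move=> f; apply: fpsP => n /=; rewrite big_ord_recl /= mul1r subn0 big1 ?addr0 //.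
by move=> i _; rewrite mul0r.
Qed.
Fact fps_mulDl : left_distributive fps_mul fps_add.
Proof.
move=> f g h; apply: fpsP => n /=; rewrite -big_split /=.
by apply: eq_bigr => i _; rewrite mulrDl.
Qed.
Fact fps_1neq0 : fps_one != 0 :> fps R.
Proof.
apply/eqP => /(congr1 (fun f => fps_coef f 0%N)) /= /eqP.
by rewrite oner_eq0.
Qed.
HB.instance Definition _ := GRing.Zmodule_isComNzRing.Build (fps R)
  fps_mulA fps_mulC fps_mul1 fps_mulDl fps_1neq0.

Definition fps_unit : pred (fps R) := fun f => `[< exists g, g * f = 1 >].
Definition fps_inv (f : fps R) : fps R :=
  if pselect (exists g, g * f = 1) is left fU then projT1 (cid fU) else f.

Fact fps_mulV : {in fps_unit, left_inverse 1 fps_inv *%R}.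
Proof.
move=> f /asboolP fU; rewrite /fps_inv; case: pselect => // fU'.
by case: cid.
Qed.
Fact fps_unitP (f g : fps R) : g * f = 1 -> fps_unit f.
Proof. by move=> gf; apply/asboolP; exists g. Qed.
Fact fps_inv_out : {in [predC fps_unit], fps_inv =1 id}.
Proof.
move=> f /asboolPn fNU; rewrite /fps_inv; case: pselect => // fU.
Qed.
HB.instance Definition _ := GRing.ComNzRing_hasMulInverse.Build (fps R)
  fps_mulV fps_unitP fps_inv_out.

Definition fpsX : fps R := FPS (fun n => (n == 1%N)%:R).

End FPS.

Local Open Scope classical_set_scope.
Local Open Scope card_scope.

Section Submodules.
Variables (R : nzRingType) (V : lmodType R).
Implicit Types (S B : set V).

Definition lin_indep B := forall (s : seq V) (c : V -> R),
  uniq s -> [set` s] `<=` B -> \sum_(b <- s) c b *: b = 0 ->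
  {in s, forall b, c b = 0}.

Definition lin_span B : set V := [set v | exists (s : seq V) (c : V -> R),
  [set` s] `<=` B /\ v = \sum_(b <- s) c b *: b].

Definition free_module S := exists B, lin_indep B /\ lin_span B = S.

Definition has_index S (m : nat) :=
  [set [set x + y | y in S] | x in [set: V]] #= `I_m.

Definition coh_submods (p n : nat) : set (set V) :=
  [set S | [/\ submod_closed [in S], has_index S (p ^ n)%N & free_module S]].

(* [fset_set] is the empty set on infinite sets, so this is the number of
   such submodules only if there are finitely many of them. *)
Definition coh_num (p n : nat) : nat := #|` fset_set (coh_submods p n)|.

End Submodules.

Arguments coh_submods {R} V p n.
Arguments coh_num {R} V p n.

(* The series \sum_(n >= 1) c_n T^n, where T stands for p^(-s). *)
Definition Zcoh (R : nzRingType) (V : lmodType R) (p : nat) : fps int :=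
  FPS (fun n => if n == 0%N then 0 else (coh_num V p n)%:Z).

(* Main.v *)
Require Import Defs.
From HB Require Import structures.
From mathcomp Require Import all_boot all_order all_algebra all_fingroup
  all_solvable.
From mathcomp Require Import finmap.
From mathcomp Require Import mathcomp_extra boolp classical_sets functions
  cardinality.

Set Implicit Arguments.
Unset Strict Implicit.
Unset Printing Implicit Defensive.

Import GRing.Theory.
Local Open Scope ring_scope.

(** Let L be the group ring, g a generator of G, tau = g - 1, and aug : L -> Zp
  the augmentation.  The ring L is commutative, so a free submodule of finite
  index is an ideal a L with a regular ([free_ideal], [zero_index]), and the
  task is to count the regular elements up to units and to compute the index of
  a L.

  Conceptually L is the fibre product over F_p of Zp and Zp[zeta], where zeta
  is a primitive p-th root of unity: an element is a pair (x, y) with x = y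
  modulo zeta - 1.  It is a nonunit exactly when neither component is a unit;
  if it is also regular, then up to units of the two factors it is
  (p ^ (i + 1), (zeta - 1) ^ (j + 1)).  The units of L have index p - 1 in the
  pairs of units, which leaves p - 1 classes for each (i, j), and the index of
  the ideal is p ^ (i + j + 2).  So there are (n - 1) (p - 1) ideals of index
  p ^ n when n > 0.

  The proof works inside L.  The annihilator of tau is the set of constant
  functions ([ann_tau]) and the ideal generated by tau is the kernel of aug
  ([divides_tau]).  Since tau ^ p is divisible by p and L is p-adically
  complete, an element is invertible as soon as its augmentation is
  ([gr_unit]).  The classes of regular nonunits are represented by the sums
  of the constant function c p ^ i and tau ^ (j + 1), with 0 < c < p
  ([standard_exists], [std_ideal_inj]).  Their index comes from a chain of
  subgroups, most of whose steps are copies of L / (p, tau) = F_p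
  ([standard_transversal]). *)

(** * Divisibility and adic completeness *)

Section Divisibility.
Variable A : comNzRingType.
Implicit Types a b c q t x y : A.

Definition divides a x := exists y, x = a * y.

Lemma divides0 a : divides a 0.
Proof. by exists 0; rewrite mulr0. Qed.

Lemma dividesD a x y : divides a x -> divides a y -> divides a (x + y).
Proof. by move=> [u ->] [v ->]; exists (u + v); rewrite mulrDr. Qed.

Lemma dividesN a x : divides a x -> divides a (- x).
Proof. by move=> [u ->]; exists (- u); rewrite mulrN. Qed.

Lemma dividesB a x y : divides a x -> divides a y -> divides a (x - y).
Proof. by move=> ax ay; apply/dividesD/dividesN. Qed.

Lemma dividesMl a x y : divides a y -> divides a (x * y).
Proof. by move=> [u ->]; exists (x * u); rewrite mulrCA. Qed.

Lemma dividesXM a b x m k : a ^+ m = b * x -> divides (b ^+ k) (a ^+ (m * k)).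
Proof. by move=> e; exists (x ^+ k); rewrite exprM e exprMn. Qed.

Lemma divides_expS a x k : divides (a ^+ k.+1) x -> divides (a ^+ k) x.
Proof. by move=> [y ->]; exists (a * y); rewrite exprSr mulrA. Qed.

Lemma divides_assoc a b b' c x : b * b' = 1 -> a = b * c ->
  divides a x <-> divides c x.
Proof.
move=> bb ->; split=> [[y ->]|[y ->]].
  by exists (b * y); rewrite mulrA [c * b]mulrC.
by exists (b' * y); rewrite mulrAC !mulrA bb mul1r mulrC.
Qed.

(** The middle binomial coefficients are divisible by p. *)
Lemma exprD1_prime p x : prime p ->
  exists c, (x + 1) ^+ p = 1 + x ^+ p + p%:R * c.
Proof.
case: p => // p p_pr.
have [c cE] : divides (p.+1%:R : A) (\sum_(i < p) x ^+ i.+1 *+ 'C(p.+1, i.+1)).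
  elim/big_ind: _ => [||i _]; [exact: divides0 | exact: dividesD |].
  have /dvdnP[m ->] : (p.+1 %| 'C(p.+1, i.+1))%N.
    by rewrite prime_dvd_bin //= ltnS.
  by exists (x ^+ i.+1 *+ m); rewrite mulr_natl mulrnA.
exists c; rewrite exprD1n big_ord_recl big_ord_recr /= bin0 /bump /= add1n binn.
by rewrite cE !mulr1n addrA addrAC.
Qed.

(** Separatedness and completeness for the topology given by the powers of q,
  with sequences normalised to have consecutive terms congruent mod q ^+ k. *)
Definition adically_complete q :=
  (forall x, (forall k, divides (q ^+ k) x) -> x = 0) /\
  (forall d : nat -> A, (forall k, divides (q ^+ k) (d k.+1 - d k)) ->
     exists l, forall k, divides (q ^+ k) (l - d k)).

(** The limit of the partial sums of the geometric series of ratio - q c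
  inverts 1 + q c. *)
Lemma unit_mod_adic q a b c :
  adically_complete q -> a * b = 1 + q * c -> exists b', a * b' = 1.
Proof.
move=> [sep compl] ab.
pose d k := \sum_(i < k) (- (q * c)) ^+ i.
have [k|l lP] := compl d.
  rewrite /d big_ord_recr /= addrAC subrr add0r.
  by exists ((- c) ^+ k); rewrite -mulrN exprMn.
exists (b * l); apply/eqP; rewrite -subr_eq0; apply/eqP/sep => k.
rewrite mulrA ab -(subrK (d k) l).
have -> : (1 + q * c) * (l - d k + d k) - 1 =
    (1 + q * c) * (l - d k) - (1 + ((- (q * c)) - 1) * d k).
  by rewrite mulrDr opprD -addrA [_ * d k - 1]addrC -mulNr opprB opprK addrCA.
apply: dividesB; first exact/dividesMl/lP.
by rewrite /d -subrX1 addrC subrK; exists ((- c) ^+ k); rewrite -mulrN exprMn.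
Qed.

End Divisibility.

(** * The p-adic integers *)

Section Padic.
Variables (p : nat) (p_pr : prime p).
Local Notation Zp := (padic_int p_pr).
Implicit Types x y : Zp.

Let pX_gt0 k : (0 < p ^ k)%N. Proof. by rewrite expn_gt0 prime_gt0. Qed.

Lemma pres_lt x k : (x k < p ^ k)%N.
Proof. by rewrite -pres_mod ltn_pmod. Qed.

Lemma pres0 k : (0 : Zp) k = 0%N.
Proof. exact: mod0n. Qed.

Lemma presD x y k : (x + y) k = ((x k + y k) %% p ^ k)%N.
Proof. by []. Qed.

Lemma presM x y k : (x * y) k = ((x k * y k) %% p ^ k)%N.
Proof. by []. Qed.

Lemma pres_nat n k : (n%:R : Zp) k = (n %% p ^ k)%N.
Proof.
by elim: n => [|n IHn]; rewrite ?pres0 ?mod0n // -addn1 natrD presD IHn modnDm.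
Qed.

Lemma pres_trunc x m k : (m <= k)%N -> x m = (x k %% p ^ m)%N.
Proof.
elim: k => [|k IHk]; first by rewrite leqn0 => /eqP ->; rewrite pres_mod.
rewrite leq_eqVlt => /predU1P[->|]; first by rewrite pres_mod.
by rewrite ltnS => mk; rewrite (IHk mk) presP modn_dvdm // dvdn_exp2l.
Qed.

Lemma pres_pX k j : ((p%:R : Zp) ^+ k) j = (p ^ k %% p ^ j)%N.
Proof. by rewrite -natrX pres_nat. Qed.

Lemma pres_subr x y k : (x k == y k) = ((x - y) k == 0%N).
Proof.
rewrite -{1}[x](subrK y) (presD (x - y)) -{2}(pres_mod y k) -{2}[y k]add0n.
by rewrite eqn_modDr pres_mod mod0n.
Qed.

(** The quotient is obtained by dividing the residues of x beyond the k-th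
  by p ^ k. *)
Lemma divides_pX x k : divides (p%:R ^+ k) x <-> x k = 0%N.
Proof.
split=> [[y ->]|xk0].
  by rewrite presM pres_pX modnn mul0n mod0n.
have dvx j : (p ^ k %| x (j + k))%N.
  by rewrite /dvdn -pres_trunc ?xk0 // leq_addl.
have cP j : (x (j + k) %/ p ^ k = x (j.+1 + k) %/ p ^ k %[mod p ^ j])%N.
  by rewrite !modn_divl -expnD presP addSn modn_mod.
exists (padic_of p_pr cP); apply: padicP => j.
rewrite presM pres_pX /= modnMm mulnC divnK //.
by apply: pres_trunc; rewrite leq_addr.
Qed.

(** The limit of d is the diagonal sequence of residues. *)
Lemma padic_complete : adically_complete (p%:R : Zp).
Proof.
split=> [x xP | d dP].
  by apply: padicP => k; rewrite pres0; apply/divides_pX.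
have cP k : (d k k = d k.+1 k.+1 %[mod p ^ k])%N.
  rewrite pres_mod -pres_trunc //; apply/eqP.
  by rewrite eq_sym pres_subr; apply/eqP/divides_pX.
exists (padic_of p_pr cP) => k; apply/divides_pX/eqP.
by rewrite -pres_subr /= pres_mod.
Qed.

Lemma padic_mulpI x : p%:R * x = 0 -> x = 0.
Proof.
move=> px0; apply: padicP => k; rewrite pres0.
have: (p%:R ^+ 1 * x) k.+1 = 0%N by rewrite expr1 px0 pres0.
rewrite presM pres_pX modnMml expn1 expnS -muln_modr -presP => /eqP.
by rewrite muln_eq0 gtn_eqF ?prime_gt0 // => /eqP.
Qed.

End Padic.

(** The properties of the p-adic integers on which the count depends: p is not
  a zero divisor, the ring is p-adically complete, and 0, ..., p ^ k - 1
  represent the classes modulo p ^ k without repetition. *)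
Record padic_like (p : nat) (R : comNzRingType) : Prop := PadicLike {
  pl_complete : adically_complete (p%:R : R);
  pl_mulpI : forall x : R, p%:R * x = 0 -> x = 0;
  pl_res : forall k (x : R), exists r,
    (r < p ^ k)%N /\ divides (p%:R ^+ k) (x - r%:R);
  pl_nat : forall k r, divides (p%:R ^+ k) (r%:R : R) -> (p ^ k %| r)%N }.

Lemma padic_int_like p (p_pr : prime p) : padic_like p (padic_int p_pr).
Proof.
split=> [||k x|k r]; [exact: padic_complete | exact: padic_mulpI | |].
  exists (x k); split; first exact: pres_lt.
  by apply/divides_pX/eqP; rewrite -pres_subr pres_nat pres_mod.
by move/divides_pX; rewrite pres_nat => /eqP.
Qed.

Section PadicLike.
Variables (p : nat) (p_pr : prime p) (R : comNzRingType).
Hypothesis R_padic : padic_like p R.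
Implicit Types x y : R.

Lemma padic_mulpXI k x : p%:R ^+ k * x = 0 -> x = 0.
Proof.
elim: k => [|k IHk]; rewrite ?mul1r // exprS -mulrA.
by move/(pl_mulpI R_padic)/IHk.
Qed.

Lemma padic_ndvd1 : ~ divides (p%:R : R) 1.
Proof.
move=> p1; have := @pl_nat _ _ R_padic 1 1; rewrite expr1 => /(_ p1).
by rewrite expn1 dvdn1 => /eqP p_eq1; move: p_pr; rewrite p_eq1.
Qed.

Lemma padic_resp x : exists2 r, (r < p)%N & divides p%:R (x - r%:R).
Proof. by have [r []] := pl_res R_padic 1 x; exists r. Qed.

Lemma padic_natXI k c d : (c < p ^ k)%N -> (d < p ^ k)%N ->
  divides (p%:R ^+ k : R) (c%:R - d%:R) -> c = d.
Proof.
wlog cd : c d / (d <= c)%N => [IH|] c_lt d_lt; last first.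
  rewrite -natrB // => /(pl_nat R_padic) dv.
  apply/eqP; rewrite eqn_leq cd andbT -subn_eq0.
  apply: contraTT dv; rewrite -lt0n => cd_gt0.
  by rewrite gtnNdvd // (leq_ltn_trans (leq_subr _ _)).
case/orP: (leq_total c d) => le_cd; last exact: IH.
by move/dividesN; rewrite opprB => ?; apply/esym/IH.
Qed.

Lemma padic_natI c d : (c < p)%N -> (d < p)%N ->
  divides (p%:R : R) (c%:R - d%:R) -> c = d.
Proof.
rewrite -[X in divides X]expr1 -[X in (_ < X)%N]expn1 => *.
exact: (@padic_natXI 1).
Qed.

(** A Bezout coefficient of the residue of x gives an inverse modulo p. *)
Lemma padic_unit x : ~ divides p%:R x -> exists y, x * y = 1.
Proof.
have [r r_lt xr] := padic_resp x; have [r0|r_gt0 px] := posnP r.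
  by rewrite r0 subr0 in xr.
have r_co : coprime r p by rewrite coprime_sym prime_coprime // gtnNdvd.
case: (egcdnP p r_gt0) => u v; rewrite (eqP r_co) => e _.
have [c cE] : divides p%:R (x * u%:R - 1).
  rewrite -[x](subrK r%:R) mulrDl -natrM [(r * u)%N]mulnC e natrD natrM.
  rewrite !addrA addrK [_ * u%:R]mulrC; apply: dividesD; first exact: dividesMl.
  by apply: dividesMl; exists 1; rewrite mulr1.
apply: (unit_mod_adic (b := u%:R) (c := c) (pl_complete R_padic)).
by rewrite -cE addrC subrK.
Qed.

Lemma padic_natP c : (0 < c < p)%N -> exists y : R, c%:R * y = 1.
Proof.
case/andP=> c_gt0 c_lt; apply: padic_unit => pc.
suff c0 : c = 0%N by rewrite c0 in c_gt0.
by apply: padic_natI; rewrite ?subr0 ?prime_gt0.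
Qed.

Lemma padic_factor x : x <> 0 ->
  exists i u, x = p%:R ^+ i * u /\ ~ divides p%:R u.
Proof.
move=> x0; have ex : exists k, ~~ `[< divides (p%:R ^+ k) x >].
  apply: contrapT => /forallNP xk; apply: x0; apply: (pl_complete R_padic).1.
  by move=> k; apply/asboolP/negPn/negP/xk.
case: (ex_minnP ex) => -[|k] /asboolPn xk kmin.
  by case: xk; exists x; rewrite mul1r.
have [u xu] : divides (p%:R ^+ k) x.
  by apply: contrapT => /asboolPn/kmin; rewrite ltnn.
exists k, u; split=> // -[v uv]; apply: xk.
by exists v; rewrite xu uv exprSr mulrA.
Qed.

End PadicLike.

(** * Group rings of abelian groups *)

(** A copy of the group ring whose type records that the group is abelian, so
  that it can carry the structure of a commutative ring. *)
Definition ab_group_ring (R : comNzRingType) (G : finGroupType)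
  of abelian [set: G]%SET := group_ring R G.

Section AbelianGroupRing.
Variables (R : comNzRingType) (G : finGroupType).
Variable abG : abelian [set: G]%SET.
Local Notation RG := (ab_group_ring R abG).
Implicit Types (x y : RG) (m : R) (h : G).

HB.instance Definition _ := GRing.NzRing.on RG.

Fact ab_group_ring_mulC : commutative (@GRing.mul RG).
Proof.
move=> x y; apply/ffunP => h; rewrite !ffunE.
rewrite (reindex_inj (inj_comp (mulgI h) invg_inj)) /=.
apply: eq_bigr => k _; rewrite mulrC; congr (y _ * x _).
by rewrite invMg invgK -mulgA mulVg mulg1.
by have /centsP-> := abG; rewrite ?inE.
Qed.

HB.instance Definition _ :=
  GRing.PzRing_hasCommutativeMul.Build RG ab_group_ring_mulC.

Definition aug x : R := \sum_h x h.
Definition gr_const m : RG := [ffun=> m].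
Definition gr_scal m : RG := [ffun h => if h == 1%g then m else 0].
Definition gr_elt h : RG := [ffun k => (k == h)%:R].

Fact aug_is_zmod_morphism : zmod_morphism aug.
Proof.
by move=> x y; rewrite /aug -sumrB; apply: eq_bigr => h _; rewrite !ffunE.
Qed.

Fact aug_is_monoid_morphism : monoid_morphism aug.
Proof.
split=> [|x y].
  rewrite /aug (bigD1 1%g) //= big1 ?addr0 => [|h /negPf h1]; rewrite ffunE.
    by rewrite eqxx.
  by rewrite h1.
rewrite /aug; under eq_bigr => h _ do rewrite ffunE.
rewrite exchange_big mulr_suml; apply: eq_bigr => k _ /=.
by rewrite -mulr_sumr [in RHS](reindex_inj (mulgI k^-1)%g).
Qed.

HB.instance Definition _ :=
  GRing.isZmodMorphism.Build RG R aug aug_is_zmod_morphism.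
HB.instance Definition _ :=
  GRing.isMonoidMorphism.Build RG R aug aug_is_monoid_morphism.

Lemma augM x y : aug (x * y) = aug x * aug y.
Proof. exact: rmorphM. Qed.

Lemma aug_const m : aug (gr_const m) = m *+ #|G|.
Proof.
by rewrite /aug -sumr_const; apply: eq_bigr => h _; rewrite ffunE.
Qed.

Lemma aug_scal m : aug (gr_scal m) = m.
Proof.
rewrite /aug (bigD1 1%g) //= big1 ?addr0 => [|h /negPf h1]; rewrite ffunE.
  by rewrite eqxx.
by rewrite h1.
Qed.

Lemma gr_mul_const x m : x * gr_const m = gr_const (aug x * m).
Proof.
apply/ffunP => h; rewrite !ffunE mulr_suml.
by apply: eq_bigr => k _; rewrite ffunE.
Qed.

Lemma gr_scalE m x h : (gr_scal m * x) h = m * x h.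
Proof.
rewrite ffunE (bigD1 1%g) //= big1 ?addr0 => [|k /negPf k1]; rewrite ffunE.
  by rewrite eqxx invg1 mul1g.
by rewrite k1 mul0r.
Qed.

Lemma gr_eltE h x k : (gr_elt h * x) k = x (h^-1 * k)%g.
Proof.
rewrite ffunE (bigD1 h) //= big1 ?addr0 => [|l /negPf hl]; rewrite ffunE.
  by rewrite eqxx mul1r.
by rewrite hl mul0r.
Qed.

Lemma gr_elt1 : gr_elt 1 = 1.
Proof. by apply/ffunP => h; rewrite !ffunE. Qed.

Lemma gr_eltX h n : gr_elt (h ^+ n) = gr_elt h ^+ n.
Proof.
elim: n => [|n IHn]; first by rewrite gr_elt1.
rewrite exprS -IHn; apply/ffunP => k.
rewrite gr_eltE !ffunE expgS; congr (nat_of_bool _)%:R.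
by apply/eqP/eqP => [->|<-]; rewrite ?mulKVg ?mulKg.
Qed.

Lemma gr_scal1 : gr_scal 1 = 1.
Proof. by apply/ffunP => h; rewrite !ffunE; case: eqP. Qed.

Lemma gr_expand x : x = \sum_h gr_scal (x h) * gr_elt h.
Proof.
apply/ffunP => k; rewrite sum_ffunE (bigD1 k) //= big1 ?addr0 => [|h hk].
  by rewrite gr_scalE ffunE eqxx mulr1.
by rewrite gr_scalE ffunE eq_sym (negPf hk) mulr0.
Qed.

Lemma gr_scal_aug x : gr_scal (aug x) = \sum_h gr_scal (x h).
Proof.
apply/ffunP => k; rewrite sum_ffunE ffunE.
under eq_bigr => h _ do rewrite ffunE.
by case: eqP => // _; rewrite big1.
Qed.

End AbelianGroupRing.
Arguments gr_const {R G abG} m.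
Arguments gr_scal {R G abG} m.
Arguments gr_elt {R G abG} h.

(** * The augmentation ideal of a cyclic group *)

Section CyclicGroupRing.
Variables (R : comNzRingType) (G : finGroupType).
Variables (abG : abelian [set: G]%SET) (g : G).
Hypothesis genG : [set: G]%SET = <[g]>%g.
Local Notation RG := (ab_group_ring R abG).
Implicit Types x y : RG.

Definition gr_tau (g : G) : RG := gr_elt g - 1.
Local Notation tau := (gr_tau g).

Lemma aug_tau : aug tau = 0.
Proof.
rewrite rmorphB rmorph1 /= /aug (bigD1 g) //= big1 => [|h /negPf hg].
  by rewrite ffunE eqxx addr0 subrr.
by rewrite ffunE hg.
Qed.

Lemma tau_const m : tau * gr_const m = 0.
Proof.
by rewrite gr_mul_const aug_tau mul0r; apply/ffunP => h; rewrite !ffunE.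
Qed.

(** Writing x as the sum of the x h [h], the difference is a combination of
  the [g ^ n] - 1, which are multiples of [g] - 1. *)
Lemma tau_aug x : divides tau (x - gr_scal (aug x)).
Proof.
rewrite [X in X - _]gr_expand gr_scal_aug -sumrB.
elim/big_ind: _ => [||h _]; [exact: divides0 | exact: dividesD |].
have /cycleP[n ->] : h \in <[g]>%g by rewrite -genG inE.
rewrite gr_eltX -[X in _ - X]mulr1 -mulrBr; apply: dividesMl.
by exists (\sum_(i < n) gr_elt g ^+ i); rewrite subrX1.
Qed.

Lemma divides_tau x : divides tau x <-> aug x = 0.
Proof.
split=> [[y ->]|x0]; first by rewrite rmorphM /= aug_tau mul0r.
suff -> : x = x - gr_scal (aug x) by exact: tau_aug.
suff -> : gr_scal (aug x) = 0 :> RG by rewrite subr0.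
by rewrite x0; apply/ffunP => h; rewrite !ffunE; case: eqP.
Qed.

(** Being killed by tau means being invariant under translation by g. *)
Lemma ann_tau x : tau * x = 0 -> exists m, x = gr_const m.
Proof.
move=> /eqP; rewrite mulrBl mul1r subr_eq0 => /eqP gx.
exists (x 1%g); apply/ffunP => h; rewrite ffunE.
have /cycleP[n ->] : h \in <[g]>%g by rewrite -genG inE.
by elim: n => // n <-; rewrite -[in LHS]gx gr_eltE expgS mulKg.
Qed.

End CyclicGroupRing.
Arguments gr_tau {R G abG} g.

(** * Transversals and indices *)

Section Transversal.
Variable V : zmodType.
Implicit Types (A B C : V -> Prop) (s : nat -> V).

Definition subgroup B := B 0 /\ forall x y, B x -> B y -> B (x - y).

Lemma subgroupN B x : subgroup B -> B x -> B (- x).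
Proof. by move=> [B0 sgB] Bx; rewrite -[- x]sub0r; apply: sgB. Qed.

(** The first n terms of s represent the cosets of B in A, without
  repetition. *)
Definition transversal A B n s := [/\ forall k, (k < n)%N -> A (s k),
  forall x, A x -> exists2 k, (k < n)%N & B (x - s k) &
  forall k l, (k < n)%N -> (l < n)%N -> B (s k - s l) -> k = l].

Lemma transversal_trans A B C m n s s' :
  subgroup A -> subgroup B ->
  (forall x, B x -> A x) -> (forall x, C x -> B x) ->
  transversal A B m s -> transversal B C n s' ->
  transversal A C (m * n) (fun r => s (r %/ n)%N + s' (r %% n)%N).
Proof.
move=> sgA sgB BA CB [sA sx sinj] [sB' sx' sinj'].
have bd r : (r < m * n)%N -> (r %/ n < m)%N /\ (r %% n < n)%N.
  case: n {sB' sx' sinj'} => [|n]; first by rewrite muln0.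
  by rewrite ltn_divLR // ltn_mod.
split=> [r /bd[r1 r2]|x /sx[k km]|r t /bd[r1 r2] /bd[t1 t2]].
- rewrite -[s' _]opprK; apply: sgA.2; first exact: sA.
  exact/BA/(subgroupN sgB)/sB'.
- move=> /sx'[l ln Cx]; have n_gt0 : (0 < n)%N by exact: leq_trans ln.
  exists (k * n + l)%N; last first.
    by rewrite divnMDl // divn_small // addn0 modnMDl modn_small // opprD addrA.
  rewrite (leq_trans (n := k.+1 * n)) ?leq_mul2r ?km ?orbT //.
  by rewrite mulSn addnC ltn_add2r.
- rewrite opprD addrACA => Crt.
  have Brt : B (s' (r %% n)%N - s' (t %% n)%N) by apply: sgB.2; apply: sB'.
  have e1 : (r %/ n = t %/ n)%N.
    apply: sinj => //; have := sgB.2 _ _ (CB _ Crt) Brt.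
    by rewrite addrK.
  rewrite (divn_eq r n) (divn_eq t n) e1; congr (_ + _)%N.
  by apply: sinj' => //; rewrite e1 subrr add0r in Crt.
Qed.

End Transversal.

Section Index.
Local Open Scope classical_set_scope.
Local Open Scope card_scope.
Variables (R : nzRingType) (V : lmodType R).

Lemma coset_eq (S : set V) x y : subgroup S ->
  [set x + z | z in S] = [set y + z | z in S] <-> S (x - y).
Proof.
move=> sgS; split=> [e|Sxy].
  have : [set y + z | z in S] x.
    by rewrite -e /=; exists 0; rewrite ?addr0 //; exact: sgS.1.
  by move=> /= [z Sz <-]; rewrite addrAC subrr add0r.
apply/seteqP; split=> _ [z Sz <-] /=.
  exists ((x - y) - (- z)); first exact: sgS.2 Sxy (subgroupN sgS Sz).
  by rewrite opprK addrA addrCA subrr addr0.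
exists (z - (x - y)); first exact: sgS.2.
by rewrite opprB addrC -addrA subrK addrC.
Qed.

Lemma transversal_has_index (S : set V) n s : subgroup S ->
  transversal (fun=> True) S n s -> has_index S n.
Proof.
move=> sgS [_ sx sinj]; pose F x := [set x + z | z in S].
rewrite /has_index (_ : image _ _ = (F \o s) @` `I_n).
  apply: inj_card_eq => k l; rewrite !inE /= => kn ln /coset_eq.
  by move=> /(_ sgS); apply: sinj.
apply/seteqP; split=> _ [k kn <-]; last by exists (s k).
have [l ln Sl] := sx k I; exists l => //=.
by apply/esym/coset_eq.
Qed.

End Index.

(** * Free ideals of a commutative ring *)

Section FreeIdeals.
Variable A : comNzRingType.
Local Open Scope classical_set_scope.
Implicit Types (a x y : A) (S B : set A^o).

Lemma divides_subgroup a : subgroup (divides a).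
Proof. by split=> [|x y]; [exact: divides0 | exact: dividesB]. Qed.

Lemma divides_submod a : submod_closed (V := A^o) [in (divides a : set A^o)].
Proof.
split=> [|c x y]; rewrite !inE; first exact: divides0.
by move=> ax ay; apply: dividesD => //; apply: dividesMl.
Qed.

Lemma divides_regular_free a : (forall y, y * a = 0 -> y = 0) ->
  free_module (divides a : set A^o).
Proof.
move=> a_reg; exists [set a]; split.
  move=> s c s_uniq sa c0 b bs.
  have ba : b = a by exact: sa.
  rewrite {b}ba in bs *; apply: a_reg.
  move: c0; rewrite (bigD1_seq a) //= big_seq_cond big1 ?addr0 // => b.
  by move=> /andP[/sa/= ->]; rewrite eqxx.
apply/seteqP; split=> [_ [s [c [sa ->]]]|_ [y ->]].
  rewrite big_seq; elim/big_ind: _ => [||b /sa /= ->].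
  - exact: divides0.
  - exact: dividesD.
  by exists (c a); rewrite mulrC.
exists [:: a], (fun=> y); split; first by move=> b /=; rewrite inE => /eqP.
by rewrite big_seq1 mulrC.
Qed.

(** Two elements x and y of a commutative ring satisfy the relation
  y x - x y = 0, so that a basis of an ideal has at most one element. *)
Lemma free_ideal S : free_module S ->
  S = [set 0] \/
  exists a, (forall y, y * a = 0 -> y = 0) /\ S = divides a :> set A^o.
Proof.
move=> [B [indB <-]].
have [->|/set0P[a Ba]] := eqVneq B set0.
  left; apply/seteqP; split=> [_ [[|b s] [c [sB ->]]]|_ ->].
  - by rewrite big_nil.
  - by have := sB b; rewrite /= mem_head => /(_ isT).
  by exists [::], (fun=> 0); rewrite big_nil.
have BE b : B b -> b = a.
  move=> Bb; apply: contrapT => /eqP ba.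
  pose c x : A := if x == a then b else - a.
  have c0 x : x \in [:: a; b] -> c x = 0.
    apply: (indB [:: a; b] c).
    - by rewrite /= inE eq_sym ba.
    - by move=> z /=; rewrite !inE => /orP[] /eqP ->.
    rewrite big_cons big_seq1 /c eqxx (negPf ba) scaleNr /=.
    by rewrite -[b *: a]/(b * a) -[a *: b]/(a * b) mulrC subrr.
  have := c0 a; rewrite mem_head /c eqxx => /(_ isT) b0.
  have := c0 b; rewrite inE mem_head orbT /c (negPf ba) => /(_ isT)/eqP.
  by rewrite oppr_eq0 => /eqP a0; rewrite a0 b0 eqxx in ba.
right; exists a; split.
  move=> y ya; apply: (indB [:: a] (fun=> y) _ _ _ a (mem_head _ _)) => //.
    by move=> b /=; rewrite inE => /eqP ->.
  by rewrite big_seq1.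
apply/seteqP; split=> [_ [s [c [sB ->]]]|_ [y ->]].
  rewrite big_seq; elim/big_ind: _ => [||b /sB/BE ->].
  - exact: divides0.
  - exact: dividesD.
  by exists (c a); rewrite mulrC.
exists [:: a], (fun=> y); split; first by move=> b /=; rewrite inE => /eqP ->.
by rewrite big_seq1 mulrC.
Qed.

End FreeIdeals.

(** * Regular elements of the group ring up to units *)

Section PadicGroupRing.
Variables (p : nat) (p_pr : prime p) (R : comNzRingType).
Hypothesis R_padic : padic_like p R.
Variable G : finGroupType.
Variables (abG : abelian [set: G]%SET) (g : G).
Hypotheses (genG : [set: G]%SET = <[g]>%g) (cardG : #|G| = p).
Local Notation L := (ab_group_ring R abG).
Local Notation tau := (gr_tau g : L).
Local Notation K := (@gr_const R G abG).
Implicit Types a b x y z : L.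

Let divp (y : R) : divides p%:R (p%:R * y). Proof. by exists y. Qed.
Let pI := pl_mulpI R_padic.

Lemma gr_natE n x h : (n%:R * x) h = n%:R * x h.
Proof.
elim: n => [|n IHn]; first by rewrite !mul0r ffunE.
by rewrite -addn1 !natrD !mulrDl !mul1r ffunE IHn.
Qed.

Lemma gr_divides_pX k x :
  divides (p%:R ^+ k) x <-> forall h, divides (p%:R ^+ k) (x h).
Proof.
rewrite -!natrX; split=> [[y ->] h|].
  by exists (y h); rewrite gr_natE.
move=> /choice[y yP]; exists [ffun h => y h]; apply/ffunP => h.
by rewrite gr_natE ffunE yP.
Qed.

Lemma gr_complete : adically_complete (p%:R : L).
Proof.
have [sep compl] := pl_complete R_padic; split=> [x xP | d dP].
  apply/ffunP => h; rewrite ffunE; apply: sep => k.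
  by move: h; apply/gr_divides_pX.
have /choice[l lP] h : exists l : R, forall k, divides (p%:R ^+ k) (l - d k h).
  apply: compl => k.
  by have /gr_divides_pX/(_ h) := dP k; rewrite !ffunE.
by exists [ffun h => l h] => k; apply/gr_divides_pX => h; rewrite !ffunE.
Qed.

Lemma aug_constp m : aug (K m) = p%:R * m.
Proof. by rewrite aug_const cardG mulr_natl. Qed.

(** Since g ^ p = 1, the element tau ^ p equals 1 + tau ^ p - (1 + tau) ^ p, in
  which only multiples of p remain. *)
Lemma tau_pX : exists c : L, tau ^+ p = p%:R * c.
Proof.
have gp : (g ^+ p = 1)%g by rewrite -cardG -cardsT genG expg_order.
have [c cE] := exprD1_prime tau p_pr; exists (- c); move: cE.
rewrite subrK -gr_eltX gp gr_elt1 -addrA => /eqP.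
by rewrite -[X in X == _]addr0 (inj_eq (addrI 1)) eq_sym addr_eq0 mulrN => /eqP.
Qed.

(** Rescaled to have augmentation 1, the element a becomes 1 plus a multiple of
  tau, which is nilpotent modulo p: a truncated geometric series gives an
  inverse modulo p. *)
Lemma gr_unit a : ~ divides p%:R (aug a) -> exists b, a * b = 1.
Proof.
move=> /(padic_unit p_pr R_padic)[e ae].
have [b bE] := tau_aug genG (a * gr_scal e).
rewrite augM aug_scal ae gr_scal1 in bE.
have [c tc] := tau_pX; pose y := - (tau * b).
have aE : a * gr_scal e = 1 - y by rewrite opprK -bE addrC subrK.
apply: (unit_mod_adic (b := gr_scal e * \sum_(i < p) y ^+ i)
  (c := - (- b) ^+ p * c) gr_complete).
rewrite mulrA aE -[LHS]opprK -mulNr opprB -subrX1 opprB /y -mulrN exprMn tc.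
by rewrite -mulrA -mulrN mulNr [c * _]mulrC.
Qed.

Lemma tauX_const k m : tau ^+ k.+1 * K m = 0.
Proof. by rewrite exprSr -mulrA tau_const mulr0. Qed.

(** An element of both the augmentation ideal and its annihilator is constant
  of augmentation 0, hence 0. *)
Lemma tauX_ann k x : tau ^+ k.+1 * x = 0 -> tau * x = 0.
Proof.
elim: k => [|k IHk]; rewrite ?expr1 // exprS -mulrA => t0; apply: IHk.
have [m mE] := ann_tau genG t0; rewrite mE.
have /pI -> : p%:R * m = 0.
  by rewrite -aug_constp -mE exprS -mulrA augM aug_tau mul0r.
by apply/ffunP => h; rewrite !ffunE.
Qed.

(** Each quotient of consecutive positive powers of the augmentation ideal is
  the residue field, through the augmentation. *)
Lemma tauX_dividesS k x :
  divides (tau ^+ k.+2) (tau ^+ k.+1 * x) <-> divides p%:R (aug x).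
Proof.
split=> [[d]|[m]]; last first.
  rewrite -aug_constp => xm.
  have /(divides_tau genG)[d dE] : aug (x - K m) = 0.
    by rewrite rmorphB /= xm subrr.
  rewrite -[x](subrK (K m)) dE mulrDr tauX_const addr0.
  by exists d; rewrite [in RHS]exprSr mulrA.
rewrite [in RHS]exprSr -mulrA => /eqP; rewrite -subr_eq0 -mulrBr => /eqP.
move=> /tauX_ann/(ann_tau genG)[m] /eqP; rewrite subr_eq => /eqP ->.
by rewrite rmorphD /= augM aug_tau mul0r addr0 aug_constp; exact: divp.
Qed.

(** The exponent exists because the powers of tau tend to 0 p-adically. *)
Lemma tauX_factor x : divides tau x -> x <> 0 ->
  exists j b, x = tau ^+ j.+1 * b /\ ~ divides p%:R (aug b).
Proof.
move=> tx x0; have ex : exists k, ~~ `[< divides (tau ^+ k.+1) x >].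
  apply: contrapT => /forallNP xk; apply: x0; apply: gr_complete.1 => k.
  have [c tc] := tau_pX; have [d dE] := dividesXM k tc.
  move/negP: (xk (p * k)%N) => /negPn/asboolP/divides_expS[e ->].
  by rewrite mulrC; apply: dividesMl; exists d.
case: (ex_minnP ex) => -[|j] /asboolPn jN jmin; first by rewrite expr1 in jN.
have [b xb] : divides (tau ^+ j.+1) x.
  by apply: contrapT => /asboolPn/jmin; rewrite ltnn.
by exists j, b; split=> // /(tauX_dividesS j); rewrite -xb.
Qed.

(** When R is the ring of p-adic integers Zp, and L is embedded in the product
  of Zp and Zp[zeta] by the augmentation and g |-> zeta, this is the element
  (c p ^ (i + 1), (zeta - 1) ^ (j + 1)). *)
Definition standard i j c : L := K (c%:R * p%:R ^+ i) + tau ^+ j.+1.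

Lemma aug_standard i j c : aug (standard i j c) = c%:R * p%:R ^+ i.+1.
Proof.
by rewrite rmorphD rmorphXn /= aug_tau expr0n addr0 aug_constp mulrCA -exprS.
Qed.

Lemma tau_standard i j c : tau * standard i j c = tau ^+ j.+2.
Proof. by rewrite mulrDr tau_const add0r -exprS. Qed.

Lemma aug_standard_ann i j c y : (0 < c < p)%N ->
  aug (standard i j c * y) = 0 -> aug y = 0.
Proof.
move=> /(padic_natP p_pr R_padic)[c' cc']; rewrite augM aug_standard => e.
apply: (padic_mulpXI R_padic (k := i.+1)).
by rewrite -[LHS]mul1r -{1}cc' mulrACA mulrCA e mulr0.
Qed.

Lemma standard_regular i j c y : (0 < c < p)%N ->
  y * standard i j c = 0 -> y = 0.
Proof.
move=> c_bd; rewrite mulrC => y0.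
have /(divides_tau genG)[z zE] : aug y = 0.
  by apply: (@aug_standard_ann i j c) => //; rewrite y0 rmorph0.
move: y0; rewrite zE mulrA [_ * tau]mulrC tau_standard.
exact: tauX_ann.
Qed.

(** Split off the constant part to write a as K m + tau ^+ j.+1 * b with b a
  unit; dividing by b, and then multiplying by units of the form 1 + K n,
  which fix tau, brings the unit part of m to an integer in ]0, p[. *)
Lemma standard_exists a : (forall y, y * a = 0 -> y = 0) ->
  divides p%:R (aug a) ->
  exists i j c, (0 < c < p)%N /\
    forall x, divides a x <-> divides (standard i j c) x.
Proof.
move=> a_reg aug_a0.
have K0 : K 0 = 0 by apply/ffunP => h; rewrite !ffunE.
have aug_a : aug a <> 0.
  move=> a0; have /a_reg/ffunP/(_ 1%g) : K 1 * a = 0.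
    by rewrite mulrC gr_mul_const a0 mul0r K0.
  by rewrite !ffunE; apply/eqP/oner_neq0.
have [[|i] [u [aE u1]]] := padic_factor R_padic aug_a.
  by case: u1; rewrite expr0 mul1r in aE; rewrite -aE.
have ta : divides tau (a - K (p%:R ^+ i * u)).
  apply/divides_tau => //.
  by rewrite rmorphB /= aug_constp mulrA -exprS aE subrr.
have a0 : a - K (p%:R ^+ i * u) <> 0.
  move=> /eqP; rewrite subr_eq0 => /eqP aK.
  have t0 : tau = 0 by apply: a_reg; rewrite aK tau_const.
  have [m /(congr1 (@aug _ _ _))] :=
    @ann_tau _ _ abG g genG 1 (etrans (mulr1 _) t0).
  rewrite rmorph1 aug_constp => e1; apply: (padic_ndvd1 p_pr R_padic).
  by exists m.
(* Here a = K (p ^ i * u) + tau ^+ j.+1 * b with b a unit. *)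
have [j [b [bE b1]]] := tauX_factor ta a0.
have [b' bb'] := gr_unit b1; have [u' uu'] := padic_unit p_pr R_padic u1.
pose v := aug b' * u; pose v' := aug b * u'.
have vv' : v * v' = 1.
  by rewrite mulrACA uu' mulr1 -augM mulrC bb' rmorph1.
have [c c_lt vc] := padic_resp R_padic v.
have c_bd : (0 < c < p)%N.
  rewrite c_lt andbT lt0n; apply/eqP => c0; rewrite c0 subr0 in vc.
  apply: (padic_ndvd1 p_pr R_padic).
  by have := dividesMl v' vc; rewrite mulrC vv'.
(* The unit w = 1 + K m has augmentation 1 + p m = c / v, so that w times
   K (v * p ^ i) + tau ^+ j.+1 is standard i j c. *)
have [m mE] : divides p%:R (v' * (c%:R - v)).
  by apply: dividesMl; rewrite -opprB; apply: dividesN.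
rewrite mulrBr [v' * v]mulrC vv' in mE.
have [w' ww'] : exists w', (1 + K m) * w' = 1.
  apply: gr_unit; rewrite rmorphD rmorph1 /= aug_constp => pm.
  apply: (padic_ndvd1 p_pr R_padic).
  by have := dividesB pm (divp m); rewrite addrK.
exists i, j, c; split=> // x.
apply: (@divides_assoc _ _ (b * w') (b' * (1 + K m))).
  by rewrite mulrACA bb' mul1r mulrC.
have -> : standard i j c = (1 + K m) * (K (v * p%:R ^+ i) + tau ^+ j.+1).
  rewrite mulrDr [(1 + _) * tau ^+ _]mulrDl [K m * _]mulrC.
  rewrite tauX_const mul1r addr0.
  congr (_ + _); rewrite gr_mul_const rmorphD rmorph1 /= aug_constp -mE.
  by rewrite addrC subrK [in RHS]mulrACA [v' * v]mulrC vv' mul1r.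
rewrite -mulrA [w' * _]mulrA [w' * _]mulrC ww' mul1r mulrDr [b * tau ^+ _]mulrC.
rewrite -bE gr_mul_const addrC -mulrA mulrA -augM bb' rmorph1 mul1r.
by rewrite [u * _]mulrC subrK.
Qed.

(** The augmentation of standard i j c has p-adic valuation exactly i + 1, and
  that of its divisor is a multiple of p ^ (i' + 1). *)
Lemma standard_inj_aug i j c i' j' c' : (0 < c < p)%N ->
  divides (standard i' j' c') (standard i j c) -> (i' <= i)%N.
Proof.
move=> /(padic_natP p_pr R_padic)[d cd] [w /(congr1 (@aug _ _ _))].
rewrite rmorphM /= !aug_standard => e.
have : divides (p%:R ^+ i'.+1) ((p ^ i.+1)%:R : R).
  exists (d * c'%:R * aug w); rewrite natrX.
  by rewrite -[LHS]mul1r -{1}cd mulrAC e mulrC [c'%:R * _]mulrC -!mulrA mulrCA.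
by move=> /(pl_nat R_padic); rewrite dvdn_Pexp2l ?prime_gt1.
Qed.

(** The quotient of the two elements is 1 modulo the constants, since they
  have the same product with tau; so its augmentation is 1 modulo p. *)
Lemma standard_inj_coef i j c c' : (0 < c < p)%N -> (0 < c' < p)%N ->
  divides (standard i j c') (standard i j c) -> c = c'.
Proof.
move=> c_bd c'_bd [w wE].
have /tauX_ann/(ann_tau genG)[m mE] : tau ^+ j.+2 * (1 - w) = 0.
  rewrite mulrBr mulr1 -{1}(tau_standard i j c) wE mulrA tau_standard.
  by rewrite subrr.
have augw : aug w = 1 - p%:R * m.
  by rewrite -aug_constp -mE rmorphB rmorph1 /= opprB addrC subrK.
have /(padic_mulpXI R_padic)/eqP :
    (p%:R : R) ^+ i.+1 * (c%:R - c'%:R * aug w) = 0.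
  rewrite mulrBr mulrA ![_ ^+ _ * _%:R]mulrC.
  rewrite -(aug_standard i j c) -(aug_standard i j c') wE.
  by rewrite augM subrr.
rewrite augw mulrBr mulr1 opprB addrCA addrC addr_eq0 => /eqP cc'.
case/andP: c_bd c'_bd => _ c_lt /andP[_ c'_lt].
apply: (padic_natI R_padic) => //.
by exists (- (c'%:R * m)); rewrite cc' mulrN [in RHS]mulrCA.
Qed.

(** * The index of a standard ideal *)

(** A chain from the elements of augmentation divisible by p ^ (i + 1) down to
  the ideal generated by standard i j c; consecutive terms have index p. *)
Definition flag i j c k x :=
  exists y z, x = standard i j c * y + tau ^+ k.+1 * z.

Lemma flag_subgroup i j c k : subgroup (flag i j c k).
Proof.
split=> [|_ _ [y [z ->]] [y' [z' ->]]].
  by exists 0, 0; rewrite !mulr0 addr0.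
by exists (y - y'), (z - z'); rewrite !mulrBr opprD addrACA.
Qed.

Lemma flagS i j c k x : flag i j c k.+1 x -> flag i j c k x.
Proof. by case=> y [z ->]; exists y, (tau * z); rewrite exprSr -mulrA. Qed.

Lemma flag0 i j c x : (0 < c < p)%N ->
  flag i j c 0 x <-> divides (p%:R ^+ i.+1) (aug x).
Proof.
move=> /(padic_natP p_pr R_padic)[d cd]; split=> [[y [z ->]]|[y xy]].
  rewrite rmorphD /= !augM aug_standard aug_tau mul0r addr0 mulrC.
  by apply: dividesMl; exists c%:R; rewrite mulrC.
have /(divides_tau genG)[z zE] : aug (x - standard i j c * gr_scal (d * y)) = 0.
  rewrite rmorphB /= augM aug_standard aug_scal mulrACA cd mul1r.
  by rewrite xy subrr.
by exists (gr_scal (d * y)), z; rewrite expr1 -zE addrC subrK.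
Qed.

Lemma flag_last i j c x : flag i j c j.+1 x <-> divides (standard i j c) x.
Proof.
split=> [[y [z ->]]|[y ->]]; last by exists y, 0; rewrite mulr0 addr0.
exists (y + tau * z); rewrite -(tau_standard i j c) [RHS]mulrDr mulrA.
by rewrite [standard _ _ _ * tau]mulrC.
Qed.

(** If tau ^+ k.+1 * x is in the smaller term, then comparing augmentations
  shows that the multiple of standard i j c involved is a multiple of
  tau ^+ j.+2, so that tau ^+ k.+2 divides tau ^+ k.+1 * x. *)
Lemma flag_tauX i j c k x : (0 < c < p)%N -> (k <= j)%N ->
  flag i j c k.+1 (tau ^+ k.+1 * x) <-> divides p%:R (aug x).
Proof.
move=> c_bd kj; split=> [[y [z xE]]|/(tauX_dividesS k)[z ->]]; last first.
  by exists 0, z; rewrite mulr0 add0r.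
apply/(tauX_dividesS k); rewrite xE; apply: dividesD; last by exists z.
have /(divides_tau genG)[w ->] : aug y = 0.
  apply: (@aug_standard_ann i j c) => //; move: xE => /(congr1 (@aug _ _ _)).
  by rewrite rmorphD /= !augM !exprS !augM aug_tau !mul0r addr0 => <-.
exists (tau ^+ (j - k) * w); rewrite !mulrA [_ * tau]mulrC tau_standard -exprD.
by rewrite !addSn subnKC.
Qed.

Lemma flag0_transversal i j c : (0 < c < p)%N ->
  transversal (fun=> True) (flag i j c 0) (p ^ i.+1) (fun r => r%:R).
Proof.
move=> c_bd; split=> // [x _|k l k_lt l_lt /flag0].
  have [r [r_lt xr]] := pl_res R_padic i.+1 (aug x); exists r => //.
  by apply/flag0 => //; rewrite rmorphB rmorph_nat.
by rewrite rmorphB /= !rmorph_nat => /(_ c_bd); apply: padic_natXI.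
Qed.

Lemma flag_transversal i j c k : (0 < c < p)%N -> (k <= j)%N ->
  transversal (flag i j c k) (flag i j c k.+1) p (fun r => tau ^+ k.+1 * r%:R).
Proof.
move=> c_bd kj; split=> [r _|_ [y [z ->]]|r t r_lt t_lt].
- by exists 0, r%:R; rewrite mulr0 add0r.
- have [r r_lt zr] := padic_resp R_padic (aug z); exists r => //.
  have /(flag_tauX i _ c_bd kj)[y' [z' e]] : divides p%:R (aug (z - r%:R)).
    by rewrite rmorphB /= rmorph_nat.
  by exists (y + y'), z'; rewrite -addrA -mulrBr e mulrDr addrA.
rewrite -mulrBr => /(flag_tauX _ _ c_bd kj); rewrite rmorphB /= !rmorph_nat.
exact: padic_natI.
Qed.

(** The first term of the chain has index p ^ (i + 1), and j + 1 steps of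
  index p follow. *)
Lemma standard_transversal i j c : (0 < c < p)%N ->
  exists s,
    transversal (fun=> True) (divides (standard i j c)) (p ^ (i + j).+2) s.
Proof.
move=> c_bd; suff: forall k, (k <= j.+1)%N ->
    exists s, transversal (fun=> True) (flag i j c k) (p ^ (i.+1 + k)) s.
  move=> /(_ _ (leqnn _))[s]; rewrite addSn addnS.
  rewrite (_ : flag _ _ _ _ = divides (standard i j c)); first by exists s.
  by apply/funext => x; apply/propext/flag_last.
elim=> [_|k IHk kj].
  by rewrite addn0; eexists; apply: flag0_transversal.
have [s sP] := IHk (ltnW kj); rewrite addnS expnSr; eexists.
by apply: transversal_trans sP (@flag_transversal i j c k c_bd kj) => //;
  [exact: flag_subgroup | exact: flagS].
Qed.

(** * The number of free ideals of given index *)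

Local Open Scope classical_set_scope.
Local Open Scope card_scope.
Local Notation std_ideal i j c := (divides (standard i j c) : set L^o).

Lemma has_index_inj (S : set L^o) m n :
  has_index S m -> has_index S n -> m = n.
Proof.
rewrite /has_index => Sm Sn.
by apply/card_eq_II; rewrite -(card_eql Sm).
Qed.

Lemma natr_inj (m n : nat) : m%:R = n%:R :> L -> m = n.
Proof.
move=> /(congr1 (@aug _ _ _)); rewrite !rmorph_nat => mn.
apply: (padic_natXI R_padic (k := (m + n)%N)); last first.
- by rewrite mn subrr; apply: divides0.
- by rewrite (leq_ltn_trans (leq_addl m n)) // ltn_expl // prime_gt1.
by rewrite (leq_ltn_trans (leq_addr n m)) // ltn_expl // prime_gt1.
Qed.

(** The zero ideal is free, on the empty basis; its cosets are the singletons,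
  and L contains all the natural numbers. *)
Lemma zero_index n : ~ has_index ([set 0] : set L^o) n.
Proof.
move=> /(ex_intro _ n)/finite_setP fin; apply: infinite_nat.
pose F k : set L^o := [set k%:R + y | y in [set 0]].
have F_inj : F @` [set: nat] #= [set: nat].
  apply: inj_card_eq => k l _ _ kl.
  have [y -> e] : F l (k%:R) by rewrite -kl; exists 0; rewrite ?addr0.
  by apply/esym/natr_inj; rewrite -e addr0.
rewrite -(eq_finite_set F_inj).
by apply: sub_finite_set fin => _ [k _ <-]; exists k%:R.
Qed.

Lemma standard_index i j c : (0 < c < p)%N ->
  has_index (std_ideal i j c) (p ^ (i + j).+2).
Proof.
move=> c_bd.
have [s sP] := standard_transversal i j c_bd.
exact: (@transversal_has_index _ L^o _ _ s (divides_subgroup _) sP).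
Qed.

Lemma standard_coh i j c : (0 < c < p)%N ->
  coh_submods L^o p (i + j).+2 (std_ideal i j c).
Proof.
move=> c_bd; split; [exact: divides_submod | exact: standard_index |].
by apply: divides_regular_free => y; apply: standard_regular.
Qed.

(** A generator of S is not a unit, since L has index 1 in itself; so it is
  associate to a standard element, and the index determines i + j. *)
Lemma coh_standard n S : (0 < n)%N -> coh_submods L^o p n S ->
  exists i j c, [/\ (0 < c < p)%N, n = (i + j).+2 & S = std_ideal i j c].
Proof.
move=> n_gt0 [_ Sn /free_ideal[S0|[a [a_reg SE]]]].
  by case: (@zero_index (p ^ n)); rewrite -S0.
have [pa|/gr_unit[b ab]] := pselect (divides p%:R (aug a)).
  have [i [j [c [c_bd aE]]]] := standard_exists a_reg pa.
  have SE' : S = std_ideal i j c.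
    by rewrite SE; apply/funext => x; apply/propext/aE.
  exists i, j, c; split=> //; apply/eqP.
  rewrite -(eqn_exp2l _ _ (prime_gt1 p_pr)); apply/eqP.
  by apply: (has_index_inj Sn); rewrite SE'; apply: standard_index.
have S1 : has_index S 1.
  apply: (@transversal_has_index _ _ _ _ (fun=> 0)).
    by rewrite SE; apply: divides_subgroup.
  split=> // [x _|[|k] [|l]] //; exists 0%N => //; rewrite SE subr0.
  by exists (b * x); rewrite mulrA ab mul1r.
have := has_index_inj Sn S1; rewrite -(expn0 p) => /eqP.
by rewrite eqn_exp2l ?prime_gt1 // gtn_eqF.
Qed.

Lemma std_ideal_inj i j c i' j' c' : (0 < c < p)%N -> (0 < c' < p)%N ->
  (i + j = i' + j')%N -> std_ideal i j c = std_ideal i' j' c' ->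
  i = i' /\ c = c'.
Proof.
move=> c_bd c'_bd ij e.
have d1 : divides (standard i' j' c') (standard i j c).
  by rewrite -[divides _]e; exists 1; rewrite mulr1.
have d2 : divides (standard i j c) (standard i' j' c').
  by rewrite [divides _]e; exists 1; rewrite mulr1.
have ii' : i = i'.
  apply/eqP; rewrite eqn_leq (standard_inj_aug c_bd d1).
  by rewrite (standard_inj_aug c'_bd d2).
split=> //; move: ij d1; rewrite {}ii' => /addnI <-.
exact: standard_inj_coef.
Qed.

Lemma coh_submods_card n : (0 < n)%N ->
  coh_submods L^o p n #= `I_(n.-1 * p.-1).
Proof.
move=> n_gt0; have p'_gt0 : (0 < p.-1)%N by rewrite -subn1 subn_gt0 prime_gt1.
(* The parameters i < n.-1 and c.-1 < p.-1 are the quotient and the remainder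
   of r by p.-1. *)
pose i r := (r %/ p.-1)%N; pose c r := (r %% p.-1).+1.
pose F r := std_ideal (i r) (n.-2 - i r) (c r).
have c_bd r : (0 < c r < p)%N.
  by rewrite /= -[X in (_ < X)%N](prednK (prime_gt0 p_pr)) ltnS ltn_mod.
have i_bd r : (r < n.-1 * p.-1)%N -> (i r + (n.-2 - i r)).+2 = n.
  rewrite -ltn_divLR // => rn; rewrite subnKC.
    by case: (n) rn => [|[]].
  by rewrite -ltnS; case: (n) rn => [|[]].
suff -> : coh_submods L^o p n = F @` `I_(n.-1 * p.-1).
  apply: inj_card_eq => r t; rewrite !inE /= => r_lt t_lt.
  move=> /(std_ideal_inj (c_bd r) (c_bd t))[|i_eq [c_eq]].
    by have [] := etrans (i_bd r r_lt) (esym (i_bd t t_lt)).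
  by rewrite (divn_eq r p.-1) (divn_eq t p.-1) c_eq -/(i r) i_eq.
apply/seteqP; split=> [S /(coh_standard n_gt0)[i' [j' [c' [c'_bd nE ->]]]]|].
  case/andP: c'_bd => c'_gt0 c'_ltp.
  have c'_lt : (c'.-1 < p.-1)%N by rewrite ltn_predRL prednK.
  exists (i' * p.-1 + c'.-1)%N; rewrite /= /F /i /c.
    rewrite -ltn_divLR // divnMDl // (divn_small c'_lt) addn0.
    by rewrite nE /= ltnS leq_addr.
  rewrite divnMDl // modnMDl (divn_small c'_lt) (modn_small c'_lt) addn0.
  by rewrite nE /= addKn prednK.
by move=> _ [r r_lt <-]; rewrite -{1}(i_bd r r_lt); apply: standard_coh.
Qed.

End PadicGroupRing.

(** * The generating series *)

Section PowerSeries.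
Variable R : comNzRingType.
Implicit Types f : fps R.
Local Notation T := (fpsX R).

Lemma fps_coefMX0 f : fps_coef (f * T) 0 = 0.
Proof. by rewrite /= big_ord1 mulr0. Qed.

Lemma fps_coefMXS f n : fps_coef (f * T) n.+1 = fps_coef f n.
Proof.
rewrite /= big_ord_recr big_ord_recr /= subnn subSnn mulr1 mulr0 addr0.
rewrite big1 ?add0r // => i _.
by rewrite subSn 1?ltnW // eqSS subn_eq0 leqNgt ltn_ord mulr0.
Qed.

Lemma fps_coefB f h n : fps_coef (f - h) n = fps_coef f n - fps_coef h n.
Proof. by []. Qed.

Lemma fps_coefM1BX0 f : fps_coef (f * (1 - T)) 0 = fps_coef f 0.
Proof. by rewrite mulrBr mulr1 fps_coefB fps_coefMX0 subr0. Qed.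

Lemma fps_coefM1BXS f n :
  fps_coef (f * (1 - T)) n.+1 = fps_coef f n.+1 - fps_coef f n.
Proof. by rewrite mulrBr mulr1 fps_coefB fps_coefMXS. Qed.

Lemma fps_1BX_unit : (1 - T) \is a GRing.unit.
Proof.
apply/unitrPr; exists (FPS (fun=> 1)); rewrite mulrC; apply: fpsP => -[|n].
  by rewrite fps_coefM1BX0.
by rewrite fps_coefM1BXS /= subrr.
Qed.

Lemma fps_coef_natr k n : fps_coef (k%:R : fps R) n = k%:R *+ (n == 0)%N.
Proof.
elim: k => [|k IHk]; first by rewrite mul0rn.
by rewrite -addn1 natrD [LHS]/= IHk natrD mulrnDl; case: eqP.
Qed.

(** Multiplying by (1 - T) ^+ 2 takes second differences, and those of the
  truncated linear sequence are concentrated in degree 2. *)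
Lemma fps_linear_series q : FPS (fun n => (n.-1 * q)%:R : R) =
  q%:R * T ^+ 2 / (1 - T) ^+ 2.
Proof.
apply: (canRL (mulrK _)); first exact: unitrX fps_1BX_unit.
apply: fpsP => n; rewrite !expr2 !mulrA.
case: n => [|[|[|n]]]; rewrite !(fps_coefM1BX0, fps_coefM1BXS).
- by rewrite fps_coefMX0 /= mul0n.
- by rewrite fps_coefMXS fps_coefMX0 /= mul0n !subr0.
- by rewrite !fps_coefMXS fps_coef_natr /= mul0n mul1n mulr0n !subr0.
rewrite !fps_coefMXS fps_coef_natr /= !mulSn !natrD mulr0n.
by rewrite !addrK subrr.
Qed.

End PowerSeries.

Theorem mainTheorem5 (p : nat) (p_pr : prime p) (G : finGroupType)
    (cycG : cyclic [set: G]%SET) (cardG : #|G| = p) :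
  let ZpG := group_ring (padic_int p_pr) G in
  let L : lmodType ZpG := ZpG^o in
  let T : fps int := fpsX int in
  (forall n, (0 < n)%N -> finite_set (coh_submods L p n)) /\
  Zcoh L p = (p%:R - 1) * T ^+ 2 / (1 - T) ^+ 2.
Proof.
move=> ZpG L T.
have [g genG] := cyclicP cycG.
have card_coh n : (0 < n)%N ->
    (coh_submods L p n #= `I_(n.-1 * p.-1))%card.
  exact: (coh_submods_card p_pr (padic_int_like p_pr) (cyclic_abelian cycG)
            genG cardG).
split=> [n n_gt0|].
  by apply/finite_setP; exists (n.-1 * p.-1)%N; apply: card_coh.
have -> : p%:R - 1 = p.-1%:R :> fps int.
  by rewrite -subn1 natrB ?prime_gt0.
rewrite -fps_linear_series; apply: fpsP => -[|n] //=.
by rewrite /coh_num (card_fset_set (card_coh n.+1 isT)) natz.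
Qed.
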